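(* Let $\mathsf{F}$ be a finitely generated free group, $N$ a normal subgroup of $\mathsf{F}$, and $S\subseteq \mathsf{F}$ a finite symmetric set such that the image of $S$ in $\mathsf{F}/N$ normally generates $\mathsf{F}/N$. The normed group $(\mathsf{F}/N, \|\cdot\|_N)$ is metrically weakly sofic if and only if for any finite sequence $g_1,\ldots,g_k\in B^{\mathsf{F},\|\cdot\|}_1(1)$ and any finite sequence $h_1,\ldots,h_l\in N$ (possibly with repetitions), the closure in the profinite topology of $\mathsf{F}$ of every product $g_{i_1}^{\mathsf{F}}\cdot g_{i_2}^{\mathsf{F}}\cdots g_{i_m}^{\mathsf{F}}\cdot h_1^{\mathsf{F}}\cdot h_2^{\mathsf{F}}\cdots h_l^{\mathsf{F}}$ (with $m,l\ge 0$ and $i_1,\ldots,i_m\in\{1,\ldots,k\}$) is a subset of $B^{\mathsf{F},\|\cdot\|}_m(1)\,N$.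
   Context: Norms. An invariant norm on a group $G$ is a function $\ell:G\to[0,\infty)$ with $\ell(g)=0$ iff $g=1$, $\ell(g)=\ell(g^{-1})$, $\ell(gh)\le \ell(g)+\ell(h)$ and $\ell(h^{-1}gh)=\ell(g)$ for all $g,h\in G$. A normed group is a group with an invariant norm. Metric weak soficity. A normed group $(G,\ell)$ is metrically weakly sofic if for every finite $E\subseteq G$ and every $\varepsilon>0$ there are a finite normed group $(C,\ell_C)$ (with $\ell_C$ invariant) and an injective map $\phi:E\to C$ such that: (a) for any $g,h\in E$ with $gh\in E$, $\ell_C(\phi(gh)^{-1}\phi(g)\phi(h))<\varepsilon$; (b) if $1\in E$ then $\ell_C(\phi(1))<\varepsilon$; (c) $|\ell(g)-\ell_C(\phi(g))|<\varepsilon$ for every $g\in E$. Word norms and balls. $S$ symmetric means $S=S^{-1}$. For $g\in\mathsf{F}$, $g^{\mathsf{F}}$ is the conjugacy class of $g$ in $\mathsf{F}$, and $S^{\mathsf{F}}=\bigcup_{s\in S}s^{\mathsf{F}}$. On the subgroup $\langle S^{\mathsf{F}}\rangle$ of $\mathsf{F}$, $\|g\|$ is the least $k\ge 0$ such that $g$ is a product of $k$ elements of $S^{\mathsf{F}}$ (so $\|1\|=0$), and $B^{\mathsf{F},\|\cdot\|}_j(1)=\{g\in\langle S^{\mathsf{F}}\rangle:\|g\|\le j\}$; in particular $B^{\mathsf{F},\|\cdot\|}_0(1)=\{1\}$. On $\mathsf{F}/N$, $\|x\|_N$ is the least $k\ge 0$ such that $x$ is a product of $k$ elements of the image of $S^{\mathsf{F}}$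 in $\mathsf{F}/N$. ''Normally generates'' means that the conjugates of the image of $S$ generate $\mathsf{F}/N$. Products of subsets of $\mathsf{F}$ are element-wise, the empty product being $\{1\}$. The profinite topology of $\mathsf{F}$ has as basis of open sets the cosets of normal subgroups of finite index. *)

(* Defs.v *)
From HB Require Import structures.
From mathcomp Require Import all_boot all_order all_algebra all_fingroup.
From mathcomp Require Import all_classical all_reals topology.
Set Implicit Arguments.
Unset Strict Implicit.
Unset Printing Implicit Defensive.
Import Order.TTheory GRing.Theory Num.Theory.
Local Open Scope classical_set_scope.
Local Open Scope quotient_scope.
Local Open Scope group_scope.

Section Groups.
Variable G : groupType.
Implicit Types (A B N S : set G) (g h x y : G).

Definition subgroup A : Prop :=
  [/\ A 1, forall x y, A x -> A y -> A (x * y) & forall x, A x -> A x^-1].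

Definition normal_subgroup N : Prop :=
  subgroup N /\ forall x y, N x -> N (x ^ y).

Definition finite_index A : Prop :=
  finite_set [set [set x * y | y in A] | x in [set: G]].

Definition generated A : set G := smallest subgroup A.

Definition symmetric_set S : Prop := [set x^-1 | x in S] = S.

Definition conj_class g : set G := [set g ^ h | h in [set: G]].

Definition conj_closure S : set G := \bigcup_(s in S) conj_class s.

Definition normally_generates S : Prop := generated (conj_closure S) = [set: G].

Definition set_mul A B : set G := [set x * y | x in A & y in B].

Definition product_of A (k : nat) x : Prop :=
  exists s : 'I_k -> G, (forall i, A (s i)) /\ x = \prod_(i < k) s i.

(* The value 0 outside the subgroup generated by A is a junk value. *)
Definition word_length A x : nat :=
  if pselect (exists k, `[< product_of A k x >]) is left ex_k then ex_minn ex_k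
  else 0%N.

Definition word_ball A (j : nat) : set G :=
  [set x | generated A x /\ (word_length A x <= j)%N].

End Groups.

Arguments generated {G}.

Section Free.
Variable F : groupType.

Definition free_basis n (x : 'I_n -> F) : Prop :=
  forall (H : groupType) (f : 'I_n -> H),
    (exists phi : {multiplicative F -> H}, forall i, phi (x i) = f i) /\
    (forall phi psi : {multiplicative F -> H},
      (forall i, phi (x i) = psi (x i)) -> phi =1 psi).

Definition fin_gen_free : Prop := exists n (x : 'I_n -> F), free_basis x.

End Free.

Section Quotient.
Variables (G : groupType) (N : set G) (hN : normal_subgroup N).

Definition coset_rel : rel G := fun x y => `[< N (x^-1 * y) >].

Lemma coset_rel_refl : reflexive coset_rel.
Proof. by move=> x; apply/asboolP; rewrite mulVg; case: hN => -[]. Qed.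

Lemma coset_rel_sym : symmetric coset_rel.
Proof.
move=> x y; case: hN => -[_ _ NV] _.
by apply/asboolP/asboolP => /NV; rewrite invgM invgK.
Qed.

Lemma coset_rel_trans : transitive coset_rel.
Proof.
move=> y x z /asboolP Nxy /asboolP Nyz; apply/asboolP.
case: hN => -[_ NM _] _; have := NM _ _ Nxy Nyz.
by rewrite -mulgA mulVKg.
Qed.

Definition coset_equiv : equiv_rel G :=
  EquivRel coset_rel coset_rel_refl coset_rel_sym coset_rel_trans.

Definition quotient_group : Type := {eq_quot coset_equiv}.

HB.instance Definition _ := Choice.copy quotient_group {eq_quot coset_equiv}.

Definition quotient_map (x : G) : quotient_group := \pi_{eq_quot coset_equiv} x.

Lemma quotient_map_eq x y : quotient_map x = quotient_map y <-> N (x^-1 * y).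
Proof.
split=> [/eqmodP|Nxy]; first by move=> /= /asboolP.
by apply/eqmodP => /=; apply/asboolP.
Qed.

Lemma quotient_map_surj (q : quotient_group) : exists x, q = quotient_map x.
Proof. by exists (generic_quotient.repr (q : {eq_quot coset_equiv})); rewrite /quotient_map reprK. Qed.

Let qrepr (q : quotient_group) : G := generic_quotient.repr (q : {eq_quot coset_equiv}).

Let qreprK q : quotient_map (qrepr q) = q.
Proof. exact: reprK. Qed.

Let qmul (p q : quotient_group) := quotient_map (qrepr p * qrepr q).
Let qinv (p : quotient_group) := quotient_map (qrepr p)^-1.
Let qone := quotient_map 1.

Let map_qrepr x : N (x^-1 * qrepr (quotient_map x)).
Proof. by apply/quotient_map_eq; rewrite qreprK. Qed.

Let qmulE x y : qmul (quotient_map x) (quotient_map y) = quotient_map (x * y).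
Proof.
apply/esym/quotient_map_eq; case: hN => -[_ NM _] NJ.
have := NM _ _ (NJ _ y (map_qrepr x)) (map_qrepr y).
by rewrite conjgE invgM !mulgA mulgK.
Qed.

Let qinvE x : qinv (quotient_map x) = quotient_map x^-1.
Proof.
apply/quotient_map_eq; case: hN => -[_ NM NV] NJ.
have := NJ _ x^-1 (map_qrepr x).
by rewrite conjgE !invgK mulgA mulVKg.
Qed.

Let qmulA : associative qmul.
Proof.
move=> p q r; have [x ->] := quotient_map_surj p.
have [y ->] := quotient_map_surj q; have [z ->] := quotient_map_surj r.
by rewrite !qmulE mulgA.
Qed.

Let qmul1 : left_id qone qmul.
Proof. by move=> p; have [x ->] := quotient_map_surj p; rewrite qmulE mul1g. Qed.

Let qmulr1 : right_id qone qmul.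
Proof. by move=> p; have [x ->] := quotient_map_surj p; rewrite qmulE mulg1. Qed.

Let qmulV : left_inverse qone qinv qmul.
Proof.
by move=> p; have [x ->] := quotient_map_surj p; rewrite qinvE qmulE mulVg.
Qed.

Let qmulrV : right_inverse qone qinv qmul.
Proof.
by move=> p; have [x ->] := quotient_map_surj p; rewrite qinvE qmulE mulgV.
Qed.

HB.instance Definition _ :=
  isGroup.Build quotient_group qmulA qmul1 qmulr1 qmulV qmulrV.

Let quotient_mapF : {morph quotient_map : x y / x * y^-1}.
Proof. by move=> x y; rewrite -qmulE -qinvE. Qed.

HB.instance Definition _ :=
  isGroupMorphism.Build G quotient_group quotient_map quotient_mapF.

End Quotient.

(* profinite F is a copy of F, so that F itself carries no topology. *)
Section Profinite.
Variable F : groupType.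

Definition profinite : Type := F.

HB.instance Definition _ := Choice.copy profinite F.

Definition profinite_base : set (set profinite) :=
  [set U | exists (M : set F) (x : F),
     [/\ normal_subgroup M, finite_index M & U = [set x * y | y in M]]].

Let base_cover : \bigcup_(U in profinite_base) U = [set: profinite].
Proof.
apply/seteqP; split=> // x _; exists [set: F] => //.
exists [set: F], 1; split; [by []| |].
  apply: (@sub_finite_set _ _ [set [set: F]]); last exact: finite_set1.
  move=> _ [z _ <-]; apply/seteqP; split=> // y _.
  by exists (z^-1 * y) => //; rewrite mulVKg.
by apply/seteqP; split=> // y _; exists y; rewrite ?mul1g.
Qed.

Let base_join (U V : set profinite) (t : profinite) :
  profinite_base U -> profinite_base V -> U t -> V t ->
  exists W, [/\ profinite_base W, W t & W `<=` U `&` V].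
Proof.
move=> [M [x [nM fM ->]]] [M' [x' [nM' fM' ->]]] [y My yt] [y' My' yt'].
have [[M1 MM MV] MJ] := nM; have [[M'1 MM' MV'] MJ'] := nM'.
have sI : subgroup (M `&` M').
  split=> [//|u v [? ?] [? ?]|u [? ?]]; split;
    by [exact: MM|exact: MM'|exact: MV|exact: MV'].
exists [set (t : F) * z | z in M `&` M']; split.
- exists (M `&` M'), t; split=> //.
    by split=> // u v [? ?]; split; [exact: MJ|exact: MJ'].
  have := finite_image2 setI fM fM'; apply: sub_finite_set.
  move=> _ [z _ <-] /=; exists [set z * u | u in M]; first by exists z.
  exists [set z * u | u in M']; first by exists z.
  apply/seteqP; split=> [_ [[u Mu <-] [v Mv /mulgI uv]]|_ [u [Mu Mv] <-]].
    by exists u => //; split=> //; rewrite -uv.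
  by split; exists u.
- by exists 1; rewrite ?mulg1.
- move=> _ [z [Mz Mz'] <-]; split.
    by exists (y * z); [exact: MM|rewrite mulgA yt].
  by exists (y' * z); [exact: MM'|rewrite mulgA yt'].
Qed.

HB.instance Definition _ :=
  @isBaseTopological.Build profinite (set profinite) profinite_base id
    base_cover base_join.

End Profinite.

Section Norms.
Variables (R : realType) (G : groupType).

Record invariant_norm := InvariantNorm {
  norm_fun :> G -> R;
  invariant_norm_ge0 : forall g, (0 <= norm_fun g)%R;
  invariant_norm_eq0 : forall g, norm_fun g = 0%R <-> g = 1;
  invariant_normV : forall g, norm_fun g^-1 = norm_fun g;
  invariant_normM : forall g h, (norm_fun (g * h) <= norm_fun g + norm_fun h)%R;
  invariant_normJ : forall g h, norm_fun (h^-1 * g * h) = norm_fun g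
}.

End Norms.

(* phi is total on G, but only its values on E are constrained. *)
Definition metrically_weakly_sofic (R : realType) (G : groupType)
    (l : invariant_norm R G) : Prop :=
  forall (E : set G) (eps : R), finite_set E -> (0 < eps)%R ->
  exists (C : finGroupType) (lC : invariant_norm R C) (phi : G -> C),
    [/\ set_inj E phi,
        forall g h, E g -> E h -> E (g * h) ->
          (lC ((phi (g * h)%g)^-1 * phi g * phi h)%g < eps)%R,
        E 1 -> (lC (phi 1%g) < eps)%R &
        forall g, E g -> (`|l g - lC (phi g)| < eps)%R].

Section WordNorm.
Variable G : groupType.
Implicit Types (A S : set G) (x y : G).

Lemma product_of1 A : product_of A 0 1.
Proof.
by exists (fun=> 1); split; [case|rewrite big_ord0].
Qed.

Lemma product_ofS A k x y : A x -> product_of A k y -> product_of A k.+1 (x * y).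
Proof.
move=> Ax [s [As ->]].
exists (fun i => if unlift ord0 i is Some j then s j else x); split.
  by move=> i; case: unliftP.
rewrite big_ord_recl unlift_none; congr (_ * _).
by apply: eq_bigr => i _; rewrite liftK.
Qed.

Lemma product_ofP A k x : product_of A k.+1 x ->
  exists y z, [/\ A y, product_of A k z & x = y * z].
Proof.
move=> [s [As ->]]; exists (s ord0), (\prod_(i < k) s (lift ord0 i)).
by split=> //; [exists (fun i => s (lift ord0 i))|rewrite big_ord_recl].
Qed.

Lemma product_ofM A j k x y :
  product_of A j x -> product_of A k y -> product_of A (j + k) (x * y).
Proof.
elim: j x => [|j IHj] x.
  by move=> [s [_ ->]]; rewrite big_ord0 mul1g.
move=> /product_ofP[u [v [Au Pv ->]]] Py.
by rewrite -mulgA addSn; apply: product_ofS => //; exact: IHj.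
Qed.

Lemma product_of_1 A x : A x -> product_of A 1 x.
Proof. by move=> Ax; rewrite -[x]mulg1; exact/product_ofS/product_of1. Qed.

Lemma product_ofV A k x : (forall y, A y -> A y^-1) ->
  product_of A k x -> product_of A k x^-1.
Proof.
move=> AV; elim: k x => [|k IHk] x.
  by move=> [s [_ ->]]; rewrite big_ord0 invg1; exact: product_of1.
move=> /product_ofP[u [v [Au /IHk Pv ->]]]; rewrite invgM -addn1.
by apply: product_ofM => //; apply/product_of_1/AV.
Qed.

Lemma product_ofJ A k x h : (forall y, A y -> A (y ^ h)) ->
  product_of A k x -> product_of A k (x ^ h).
Proof.
move=> AJ [s [As ->]]; exists (fun i => s i ^ h); split=> [i|]; first exact: AJ.
by rewrite conjg_prod.
Qed.

Lemma generated_product A x : (forall y, A y -> A y^-1) ->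
  generated A x -> exists k, product_of A k x.
Proof.
move=> AV gx; apply: (gx [set y | exists k, product_of A k y]); split;
  last by move=> y Ay; exists 1%N; exact: product_of_1.
split=> [|y z [j Py] [k Pz]|y [k Py]].
- by exists 0%N; exact: product_of1.
- by exists (j + k)%N; exact: product_ofM.
- by exists k; exact: product_ofV.
Qed.

Lemma word_length_le A k x : product_of A k x -> (word_length A x <= k)%N.
Proof.
move=> Px; rewrite /word_length; case: pselect => // ex_k.
by case: ex_minnP => m _; apply; apply/asboolP.
Qed.

Lemma word_lengthP A x : (exists k, product_of A k x) ->
  product_of A (word_length A x) x.
Proof.
move=> [k Px]; rewrite /word_length; case: pselect => [ex_k|[]].
  by case: ex_minnP => m /asboolP.
by exists k; apply/asboolP.
Qed.

Lemma conj_closureV S : symmetric_set S ->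
  forall y, conj_closure S y -> conj_closure S y^-1.
Proof.
move=> symS _ [s Ss [h _ <-]]; exists s^-1; last by exists h; rewrite ?conjVg.
by rewrite -symS; exists s.
Qed.

Lemma conj_closureJ S h :
  forall y, conj_closure S y -> conj_closure S (y ^ h).
Proof. by move=> _ [s Ss [u _ <-]]; exists s => //; exists (u * h); rewrite ?conjgM. Qed.

Section Norm.
Variables (R : realType) (A : set G).
Hypothesis AV : forall y, A y -> A y^-1.
Hypothesis AJ : forall h y, A y -> A (y ^ h).
Hypothesis genA : generated A = [set: G].

Let l x : R := (word_length A x)%:R%R.

Let lP x : product_of A (word_length A x) x.
Proof. by apply/word_lengthP/generated_product => //; rewrite genA. Qed.

Let l_ge0 g : (0 <= l g)%R. Proof. exact: ler0n. Qed.

Let l_eq0 g : l g = 0%R <-> g = 1.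
Proof.
split=> [/eqP|->].
  rewrite pnatr_eq0 => /eqP lg0; have := lP g; rewrite lg0 => -[s [_ ->]].
  by rewrite big_ord0.
apply/eqP; rewrite pnatr_eq0 -leqn0; exact/word_length_le/product_of1.
Qed.

Let lV g : l g^-1 = l g.
Proof.
have le h : (word_length A h^-1 <= word_length A h)%N.
  exact/word_length_le/product_ofV.
by congr (_%:R)%R; apply/eqP; rewrite eqn_leq le -{1}[g]invgK le.
Qed.

Let lM g h : (l (g * h) <= l g + l h)%R.
Proof. rewrite -natrD ler_nat; exact/word_length_le/product_ofM. Qed.

Let lJ g h : l (h^-1 * g * h) = l g.
Proof.
have le x u : (word_length A (x ^ u) <= word_length A x)%N.
  by apply/word_length_le/product_ofJ => // y; exact: AJ.
rewrite -mulgA -conjgE; congr (_%:R)%R; apply/eqP.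
by rewrite eqn_leq le -{1}[g](conjgK h) le.
Qed.

Definition word_norm : invariant_norm R G := InvariantNorm l_ge0 l_eq0 lV lM lJ.

End Norm.
End WordNorm.

Section QuotientNorm.
Variables (R : realType) (G : groupType) (N : set G) (hN : normal_subgroup N).
Variable S : set G.

Lemma image_conj_closure :
  quotient_map hN @` conj_closure S = conj_closure (quotient_map hN @` S).
Proof.
apply/seteqP; split=> [_ [_ [s Ss [h _ <-]] <-]|_ [_ [s Ss <-] [q _ <-]]].
  exists (quotient_map hN s); first by exists s.
  by exists (quotient_map hN h); rewrite ?gmulfJ.
have [h ->] := quotient_map_surj q; exists (s ^ h); last by rewrite gmulfJ.
by exists s => //; exists h.
Qed.

Lemma image_conj_closureV : symmetric_set S -> forall y,
  (quotient_map hN @` conj_closure S) y ->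
  (quotient_map hN @` conj_closure S) y^-1.
Proof.
move=> symS _ [s Ss <-]; exists s^-1; last by rewrite gmulfV.
exact: conj_closureV.
Qed.

Lemma image_conj_closureJ h y : (quotient_map hN @` conj_closure S) y ->
  (quotient_map hN @` conj_closure S) (y ^ h).
Proof. by rewrite image_conj_closure; exact: conj_closureJ. Qed.

Lemma image_conj_closure_gen : normally_generates (quotient_map hN @` S) ->
  generated (quotient_map hN @` conj_closure S) = [set: quotient_group hN].
Proof. by rewrite image_conj_closure. Qed.

Definition quotient_word_norm (symS : symmetric_set S)
    (genS : normally_generates (quotient_map hN @` S)) :
    invariant_norm R (quotient_group hN) :=
  word_norm R (image_conj_closureV symS) image_conj_closureJ
    (image_conj_closure_gen genS).

End QuotientNorm.

(* Main.v *)
(* If F/N is metrically weakly sofic, then freeness extends an approximation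
   phi : E -> C, restricted to the generators, to a morphism psi : F -> C that
   is uniformly close to phi on prescribed elements.  Its kernel is open, so a
   point y of the closure of the product has the same image under psi as a point
   of the product; the norm of psi y is thus at most m plus a small error, and
   the integer norm of y N is at most m.

   Conversely, lift E to words of minimal length and let T be the finite set of
   defects in N of these lifts.  The closure condition gives a normal subgroup M
   of finite index such that in F/M no lift of length r > 0 is a product of fewer
   than r conjugates of elements of S and boundedly many conjugates of elements
   of T.  Give the conjugates of S weight 1, those of T the weight 1/n, and every
   other element of F/M a large weight: the resulting norm on F/M takes the right
   values on the lifts and is at most 1/n on the defects. *)

From HB Require Import structures.
Require Import Defs.
From mathcomp Require Import all_boot all_order all_algebra all_fingroup.
From mathcomp Require Import all_classical all_reals topology.
From mathcomp Require Import lra.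
Set Implicit Arguments.
Unset Strict Implicit.
Unset Printing Implicit Defensive.
Import Order.TTheory GRing.Theory Num.Theory.
Local Open Scope classical_set_scope.
Local Open Scope group_scope.

(** * Subgroups as group types, and generation by a free basis *)

Section SubgroupType.
Variables (G : groupType) (A : set G) (sA : subgroup A).

Definition subgroup_pred : pred G := fun x => `[< A x >].

Let subgroup_closedP : group_closed subgroup_pred.
Proof.
case: sA => A1 AM AV; split; first exact/asboolP.
by move=> x y /asboolP Ax /asboolP Ay; apply/asboolP/AM => //; exact: AV.
Qed.

(** The proof of [subgroup A] is an argument of the type, so that the group structure can be
    inferred from the type alone. *)
Definition subgroup_type & subgroup A : Type := {x : G | subgroup_pred x}.

HB.instance Definition _ := [isSub of subgroup_type sA for @sval G subgroup_pred].
HB.instance Definition _ := [Choice of subgroup_type sA by <:].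
HB.instance Definition _ :=
  SubChoice_isSubGroup.Build G subgroup_pred (subgroup_type sA) subgroup_closedP.

End SubgroupType.

(** The universal property gives a morphism from [F] to the subgroup [A] that fixes the basis.
    Followed by the inclusion, it is an endomorphism of [F] that agrees with the identity on the
    basis, hence everywhere. *)
Lemma free_basis_generates (F : groupType) n (x : 'I_n -> F) (A : set F) :
  free_basis x -> subgroup A -> (forall i, A (x i)) -> forall y, A y.
Proof.
move=> bx sA Ax y.
pose f i : subgroup_type sA := Sub (x i) (asboolT (Ax i)).
have [[phi phiE] _] := bx (subgroup_type sA) f.
have [_ uniq] := bx F x.
rewrite -[y](uniq (val \o phi) idfun) => [|i] /=; last by rewrite phiE.
exact: asboolW (valP (phi y)).
Qed.

(** * Finite quotients and the profinite topology *)

Section FiniteGroup.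
Variables (G : groupType) (finG : finite_set [set: G]).

Definition finite_group & finite_set [set: G] : Type := G.

HB.instance Definition _ := Group.copy (finite_group finG) G.

Let elements : seq (finite_group finG) := sval (cid (proj1 (finite_seqP _) finG)).

Let mem_elements x : x \in elements.
Proof.
by have := svalP (cid (proj1 (finite_seqP _) finG)) => /seteqP[/(_ x) + _]; exact.
Qed.

Let elementsK :
  pcancel (fun x => index x elements) (fun i => Some (nth 1 elements i)).
Proof. by move=> x; rewrite nth_index. Qed.

HB.instance Definition _ := isCountable.Build (finite_group finG) elementsK.

Let elementsP : Finite.axiom (undup elements).
Proof. by move=> x; rewrite count_uniq_mem ?undup_uniq // mem_undup mem_elements. Qed.

HB.instance Definition _ := isFinite.Build (finite_group finG) elementsP.

End FiniteGroup.

Lemma finite_quotient (G : groupType) (M : set G) :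
  normal_subgroup M -> finite_index M ->
  exists (C : finGroupType) (p : UMagmaMorphism.type G C),
    (forall c, exists x, p x = c) /\ (forall x, p x = 1 <-> M x).
Proof.
move=> nM fM.
have finQ : finite_set [set: Defs.quotient_group nM].
  (* [q] sends a coset, seen as a set, to its class through a chosen element; cosets are nonempty,
     so the default 1 of [xget] is harmless. *)
  pose q (X : set G) := quotient_map nM (xget 1 X).
  have := finite_image q fM; apply: sub_finite_set => c _.
  have [x ->] := quotient_map_surj c; exists [set x * y | y in M].
    by exists x.
  have [y My xy] : [set x * y | y in M] (xget 1 [set x * y | y in M]).
    apply: (xgetPex 1); exists x; exists 1; rewrite ?mulg1 //; by case: (nM) => -[].
  by apply/esym/quotient_map_eq; rewrite -xy mulKg.
pose C : finGroupType := finite_group finQ.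
pose p : UMagmaMorphism.type G C := quotient_map nM.
exists C, p; split=> [c|x].
  by have [x ->] := quotient_map_surj (c : Defs.quotient_group nM); exists x.
split=> [px1|Mx].
  case: (nM) => -[_ _ MV] _; rewrite -[x]invgK; apply: MV.
  have : quotient_map nM x = quotient_map nM 1 by rewrite gmulf1.
  by move/quotient_map_eq; rewrite mulg1.
transitivity (quotient_map nM 1); last exact: gmulf1.
apply/quotient_map_eq.
by rewrite mulg1; case: (nM) => -[_ _ MV] _; exact: MV.
Qed.

(** A basic open set around [x] is a coset of some [M] and therefore equals [x M]; these cosets form
    a neighbourhood basis at [x]. *)
Lemma closure_profiniteP (F : groupType) (A : set (profinite F)) (x : F) :
  closure A x <-> forall M : set F, normal_subgroup M -> finite_index M ->
    exists2 y : F, A y & M (x^-1 * y).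
Proof.
split=> [clA M nM fM|sepA B].
  have [] := clA [set (x : F) * y | y in M].
    apply: open_nbhs_nbhs; split.
      exists [set [set (x : F) * y | y in M]]; last by rewrite bigcup_set1.
      by move=> U UE; exists M, x; rewrite (UE : U = _).
    by exists 1; rewrite ?mulg1 //; case: nM => -[].
  by move=> z [Az [y My xy]]; exists z => //; rewrite -xy mulKg.
rewrite nbhsE => -[U [[D sD <-] [V DV Vx]] sB].
have [M [z [nM fM VE]]] := sD V DV.
have [y Ay My] := sepA M nM fM; exists y; split=> //; apply: sB; exists V => //.
move: Vx; rewrite /= VE => -[u Mu zu]; exists (u * (x^-1 * y)).
  by case: nM => -[_ MM _] _; exact: MM.
by rewrite mulgA zu mulVKg.
Qed.

(** * Products of sets, and word lengths under morphisms *)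

Lemma mem_prod_sets (F : groupType) m (A : 'I_m -> set F) (x : F) :
  (\big[@set_mul F/[set 1]]_(a < m) A a) x <->
  exists2 s : 'I_m -> F, (forall a, A a (s a)) & x = \prod_(a < m) s a.
Proof.
elim: m A x => [|m IHm] A x.
  rewrite big_ord0; split=> [->|[s _ ->]]; last by rewrite big_ord0.
  by exists (fun=> 1); [case|rewrite big_ord0].
rewrite big_ord_recl; split.
  move=> [u Au [v /IHm[s As ->] <-]].
  exists (fun i => if unlift ord0 i is Some j then s j else u).
    by move=> i; case: unliftP => [j ->|->].
  rewrite big_ord_recl unlift_none; congr (_ * _).
  by apply: eq_bigr => i _; rewrite liftK.
move=> [s As ->]; rewrite big_ord_recl; exists (s ord0) => //.
exists (\prod_(a < m) s (lift ord0 a)) => //; apply/IHm.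
by exists (fun a => s (lift ord0 a)).
Qed.

Lemma product_of_image (G H : groupType) (p : UMagmaMorphism.type G H)
    (A : set G) k c :
  product_of (p @` A) k c -> exists2 a, product_of A k a & p a = c.
Proof.
move=> [s [As ->]].
have /choice[t tP] : forall i, exists a, A a /\ p a = s i.
  by move=> i; have [a Aa <-] := As i; exists a.
exists (\prod_(i < k) t i); first by exists t; split=> // i; have [] := tP i.
by rewrite gmulf_prod; apply: eq_bigr => i _; have [] := tP i.
Qed.

Lemma image_product_of (G H : groupType) (p : UMagmaMorphism.type G H)
    (A : set G) k a :
  product_of A k a -> product_of (p @` A) k (p a).
Proof.
move=> [s [As ->]]; exists (p \o s); split=> [i|]; last by rewrite gmulf_prod.
by exists (s i).
Qed.

Lemma product_of_generated (G : groupType) (A : set G) k x :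
  product_of A k x -> Defs.generated A x.
Proof.
move=> [s [As ->]] B [[B1 BM _] AB].
by apply: (big_ind B) => // i _; exact: AB.
Qed.

(** A short product is padded with factors 1 to the exact length [k]. *)
Lemma product_of_sub (G : groupType) (A B : set G) j k x : A `<=` B -> B 1 ->
  (j <= k)%N -> product_of A j x -> product_of B k x.
Proof.
move=> AB B1 /subnK <- [s [As ->]]; rewrite -[X in product_of _ _ X]mul1g.
apply: product_ofM; last by exists s; split=> // i; exact: AB.
by exists (fun=> 1); split=> //; rewrite big1.
Qed.

Lemma mem_word_ball (G : groupType) (A : set G) j k x :
  (j <= k)%N -> product_of A j x -> word_ball A k x.
Proof.
move=> jk Ax; split; first exact: product_of_generated Ax.
by apply: leq_trans jk; exact: word_length_le.
Qed.

(** A shortest expression of the class of [x] lifts factor by factor to an element of [G] in the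
    coset [x N]. *)
Lemma coset_word_ballP (G : groupType) (N : set G) (hN : normal_subgroup N)
    (A : set G) j x :
  (forall y, A y -> A y^-1) ->
  Defs.generated (quotient_map hN @` A) = [set: Defs.quotient_group hN] ->
  set_mul (word_ball A j) N x <->
  (word_length (quotient_map hN @` A) (quotient_map hN x) <= j)%N.
Proof.
move=> AV genA; split=> [[y [gy lyj] [z Nz <-]]|].
  have -> : quotient_map hN (y * z) = quotient_map hN y.
    by apply/esym/quotient_map_eq; rewrite mulKg.
  apply: leq_trans lyj; apply/word_length_le/image_product_of/word_lengthP.
  exact: generated_product.
have /word_lengthP/product_of_image[a Pa qa] :
    exists k, product_of (quotient_map hN @` A) k (quotient_map hN x).
  apply: generated_product; last by rewrite genA.
  by move=> _ [y Ay <-]; exists y^-1; rewrite ?gmulfV //; exact: AV.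
move=> lxj; exists a; last first.
  exists (a^-1 * x); last by rewrite mulVKg.
  by apply/quotient_map_eq.
exact: mem_word_ball lxj Pa.
Qed.

(** * Estimates for invariant norms *)

Section InvariantNormTheory.
Variables (R : realType) (G : groupType) (l : invariant_norm R G).
Local Open Scope ring_scope.

Lemma invariant_norm1 : l 1%g = 0.
Proof. exact/invariant_norm_eq0. Qed.

Lemma invariant_norm_conjg g h : l (g ^ h)%g = l g.
Proof. by rewrite conjgE mulgA invariant_normJ. Qed.

Lemma invariant_norm_distC g h : l (g^-1 * h)%g = l (h^-1 * g)%g.
Proof. by rewrite -invariant_normV invgM invgK. Qed.

Lemma invariant_norm_triangle g h k :
  l (g^-1 * k)%g <= l (g^-1 * h)%g + l (h^-1 * k)%g.
Proof. by rewrite -[in leLHS](mulVKg h k) mulgA invariant_normM. Qed.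

(** The left-hand element is [(g^-1 * g') ^ h * (h^-1 * h')], and conjugation preserves the norm. *)
Lemma invariant_norm_distM g h g' h' :
  l ((g * h)^-1 * (g' * h'))%g <= l (g^-1 * g')%g + l (h^-1 * h')%g.
Proof.
rewrite -(invariant_norm_conjg (g^-1 * g')%g h).
apply: le_trans (invariant_normM _ _ _).
by rewrite conjgE invgM !mulgA mulgK.
Qed.

Lemma invariant_norm_prod m (s : 'I_m -> G) :
  l (\prod_(i < m) s i)%g <= \sum_(i < m) l (s i).
Proof.
elim/big_ind2 : _ => [|x1 y1 x2 y2 le1 le2|//]; first by rewrite invariant_norm1.
by apply: le_trans (lerD le1 le2); exact: invariant_normM.
Qed.

Lemma invariant_norm_le_dist g h : l h <= l g + l (g^-1 * h)%g.
Proof. by rewrite -{1}(mulVKg g h) invariant_normM. Qed.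

End InvariantNormTheory.

(** * Approximations by finite normed groups, and eventual properties *)

Section Approximations.
Variables (R : realType) (G : groupType) (l : invariant_norm R G).

Record approximation := Approximation {
  approx_group : finGroupType;
  approx_norm : invariant_norm R approx_group;
  approx_map : G -> approx_group
}.

Implicit Types (a : approximation) (P Q : approximation -> Prop).

Definition approximates (E : set G) (eps : R) a : Prop :=
  let: Approximation C lC phi := a in
  [/\ set_inj E phi,
      forall g h, E g -> E h -> E (g * h) ->
        (lC ((phi (g * h)%g)^-1 * phi g * phi h)%g < eps)%R,
      E 1 -> (lC (phi 1%g) < eps)%R &
      forall g, E g -> (`|l g - lC (phi g)| < eps)%R].

(* This is a filter on approximations, but universe constraints forbid
   [set_system approximation]. *)
Definition eventually_approx P : Prop :=
  exists E eps, [/\ finite_set E, (0 < eps)%R &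
                    forall a, approximates E eps a -> P a].

Lemma eventually_mono P Q :
  (forall a, P a -> Q a) -> eventually_approx P -> eventually_approx Q.
Proof.
by move=> PQ [E [e [fE e0 EP]]]; exists E, e; split=> // a /EP; exact: PQ.
Qed.

Lemma approximatesS E E' e e' a : E `<=` E' -> (e' <= e)%R ->
  approximates E' e' a -> approximates E e a.
Proof.
case: a => C lC phi EE' ee' [inj M1 M2 M3]; split.
- by apply: sub_in2 inj => g; rewrite !inE; exact: EE'.
- by move=> g h /EE' Eg /EE' Eh /EE' Egh; exact: lt_le_trans (M1 g h _ _ _) ee'.
- by move=> /EE' E1; exact: lt_le_trans (M2 _) ee'.
- by move=> g /EE' Eg; exact: lt_le_trans (M3 _ _) ee'.
Qed.

Lemma eventually_and P Q :
  eventually_approx P -> eventually_approx Q -> eventually_approx (fun a => P a /\ Q a).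
Proof.
move=> [E [e [fE e0 EP]]] [E' [e' [fE' e'0 EQ]]].
exists (E `|` E'), (Num.min e e').
split=> [| |a Ea]; [by rewrite finite_setU|by rewrite lt_min e0|split].
  apply/EP/(approximatesS _ _ Ea); first exact: subsetUl.
  by rewrite ge_min lexx.
apply/EQ/(approximatesS _ _ Ea); first exact: subsetUr.
by rewrite ge_min lexx orbT.
Qed.

Lemma eventually_forall (I : finType) (P : I -> approximation -> Prop) :
  (forall i, eventually_approx (P i)) -> eventually_approx (fun a => forall i, P i a).
Proof.
move=> evP; suff evs (s : seq I) :
    eventually_approx (fun a => forall i, i \in s -> P i a).
  by apply: (eventually_mono _ (evs (enum I))) => a + i; apply; rewrite mem_enum.
elim: s => [|i s IHs]; first by exists set0, 1%R; split.
apply: (eventually_mono _ (eventually_and (evP i) IHs)) => a [Pi Ps] j.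
by rewrite inE => /predU1P[->|/Ps].
Qed.

(** Metric weak soficity says that the filter of eventual properties is proper. *)
Lemma eventually_ex P :
  metrically_weakly_sofic l -> eventually_approx P -> exists a, P a.
Proof.
move=> sofic [E [e [fE e0 EP]]].
have [C [lC [phi apx]]] := sofic E e fE e0.
by exists (Approximation lC phi); exact: EP.
Qed.

Lemma eventually_approximates E eps : finite_set E -> (0 < eps)%R ->
  eventually_approx (approximates E eps).
Proof. by move=> fE e0; exists E, eps. Qed.

End Approximations.

(** * Morphisms from a free group that follow an approximation *)

Lemma morphism1 (G H : groupType) (f : {multiplicative G -> H}) : f 1 = 1.
Proof. by apply: (mulgI (f 1)); rewrite -gmulfM !mulg1. Qed.

Lemma morphismV (G H : groupType) (f : {multiplicative G -> H}) x :
  f x^-1 = (f x)^-1.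
Proof. by apply: (mulgI (f x)); rewrite -gmulfM !mulgV morphism1. Qed.

Section Lifting.
Variables (R : realType) (F G : groupType) (l : invariant_norm R G).
Variables (q : UMagmaMorphism.type F G) (n : nat) (x : 'I_n -> F).
Hypothesis basis_x : free_basis x.
Local Open Scope ring_scope.

Definition extends a (psi : {multiplicative F -> approx_group a}) : Prop :=
  forall i, psi (x i) = approx_map a (q (x i)) :> approx_group (R := R) a.

(** The elements [w] that satisfy this for every [eps] form a subgroup containing the basis, hence
    are all of [F]. This avoids an induction on words. *)
Lemma eventually_extends_dist (w : F) (eps : R) : 0 < eps ->
  eventually_approx l (fun a => forall psi : {multiplicative F -> approx_group a},
      extends psi ->
      approx_norm a ((psi w)^-1 * approx_map a (q w))%g < eps).
Proof.
pose ev_dist w := forall e : R, 0 < e ->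
  eventually_approx l (fun a => forall psi : {multiplicative F -> approx_group a},
      extends psi ->
      approx_norm a ((psi w)^-1 * approx_map a (q w))%g < e).
suff : forall w, ev_dist w by move=> + e0; exact.
apply: (free_basis_generates basis_x); last first.
  move=> i e e0; exists set0, 1; split=> // a _ psi ->.
  by rewrite mulVg invariant_norm1.
split.
- move=> e e0.
  apply: (eventually_mono _ (eventually_approximates l (finite_set1 1%g) e0)).
  move=> [C lC phi] /= [_ _ l1 _] psi _.
  by rewrite gmulf1 morphism1 invg1 mul1g; exact: l1.
(* The three thirds pay for [u], for [v] and for the defect of the approximating map at [q u],
   [q v]. *)
- move=> u v ev_u ev_v e e0; have e3 : 0 < e / 3 by lra.
  have fE : finite_set [set q u; q v; q (u * v)%g].
    by rewrite !finite_setU; do !split; exact: finite_set1.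
  apply: (eventually_mono _ (eventually_and (eventually_and (ev_u _ e3) (ev_v _ e3))
    (eventually_approximates l fE e3))).
  move=> [C lC phi] [[du dv] [_ l2 _ _]] psi psi_x.
  have {du} /= := du psi psi_x; have {dv} /= := dv psi psi_x.
  have := l2 (q u) (q v); rewrite -gmulfM -mulgA invariant_norm_distC => duv.
  have {duv} := duv (or_introl (or_introl (erefl (q u))))
    (or_introl (or_intror (erefl (q v)))) (or_intror (erefl (q (u * v)%g))).
  rewrite (gmulfM (s := psi)).
  have := invariant_norm_triangle lC (psi u * psi v)%g (phi (q u) * phi (q v))%g
    (phi (q (u * v)%g)).
  have := invariant_norm_distM lC (psi u) (psi v) (phi (q u)) (phi (q v)).
  lra.
(* The error collects the distance for [u], the defect of the map at [q u^-1], [q u], and the norm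
   of its value at 1. *)
- move=> u ev_u e e0; have e4 : 0 < e / 4 by lra.
  have fE : finite_set [set q u; q u^-1%g; 1%g].
    by rewrite !finite_setU; do !split; exact: finite_set1.
  apply: (eventually_mono _ (eventually_and (ev_u _ e4)
    (eventually_approximates l fE e4))).
  move=> [C lC phi] [du [_ l2 l1 _]] psi psi_x.
  have {du} /= := du psi psi_x.
  have := l1 (or_intror (erefl 1%g)).
  have := l2 (q u^-1)%g (q u); rewrite -gmulfM mulVg gmulf1 -mulgA => d1.
  have {d1} := d1 (or_introl (or_intror (erefl (q u^-1%g))))
    (or_introl (or_introl (erefl (q u)))) (or_intror (erefl 1%g)).
  rewrite (morphismV psi) invgK.
  have := invariant_norm_le_dist lC (phi 1%g) (phi (q u^-1) * phi (q u))%g.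
  have := invariant_normM lC (psi u * (phi (q u))^-1)%g
    (phi (q u) * phi (q u^-1)%g)%g.
  rewrite -(invariant_norm_conjg lC (psi u * _)%g (phi (q u))).
  rewrite -(invariant_norm_conjg lC (phi (q u) * phi (q u^-1)%g)%g (phi (q u))).
  rewrite !conjgE !mulgA mulVg mul1g !mulgKV.
  rewrite -(invariant_norm_distC lC (psi u)).
  lra.
Qed.

Lemma eventually_extends_norm (w : F) (eps : R) : 0 < eps ->
  eventually_approx l (fun a => forall psi : {multiplicative F -> approx_group a},
      extends psi -> `|l (q w) - approx_norm a (psi w)| < eps).
Proof.
move=> eps0; have eps2 : 0 < eps / 2 by lra.
apply: (eventually_mono _ (eventually_and (eventually_extends_dist w eps2)
  (eventually_approximates l (finite_set1 (q w)) eps2))).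
move=> [C lC phi] [dw [_ _ _ /(_ _ erefl) lw]] psi psi_x.
have {dw} /= := dw psi psi_x; move: lw.
have := invariant_norm_le_dist lC (psi w) (phi (q w)).
have := invariant_norm_le_dist lC (phi (q w)) (psi w).
rewrite (invariant_norm_distC lC (phi (q w))) !ltr_norml.
move=> ? ? /andP[? ?] ?; apply/andP; split; lra.
Qed.

End Lifting.

(** * From soficity to closures of products of conjugacy classes *)

Lemma finite_index_kernel (G : groupType) (C : finGroupType)
  (psi : {multiplicative G -> C}) :
  normal_subgroup [set x | psi x = 1] /\ finite_index [set x | psi x = 1].
Proof.
split; first split; first split=> /=.
- exact: morphism1.
- by move=> y z; rewrite gmulfM => -> ->; rewrite mulg1.
- by move=> y; rewrite morphismV => ->; rewrite invg1.
- by move=> y z /= y1; rewrite conjgE !gmulfM y1 mul1g -gmulfM mulVg morphism1.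
pose coset (c : C) := [set y | psi y = c].
have := finite_image coset (@finite_finset C setT); apply: sub_finite_set => _ [y _ <-].
exists (psi y) => //; apply/seteqP; split=> [z /= yz|_ [z /= z1 <-]].
  by exists (y^-1 * z); rewrite ?mulVKg //= gmulfM morphismV yz mulVg.
by rewrite /coset /= gmulfM z1 mulg1.
Qed.

(** Modulo the kernel of a nearly isometric morphism [psi], [y] is a product of [m] elements of norm
    about 1 and [k] elements of norm about 0. The strict bound by [m.+1] suffices for an
    integer-valued norm. *)
Lemma sofic_closure_norm (R : realType) (F G : groupType)
    (l : invariant_norm R G) (q : UMagmaMorphism.type F G) n (x : 'I_n -> F)
    m (g : 'I_m -> F) k (h : 'I_k -> F) (y : F) :
  free_basis x -> metrically_weakly_sofic l ->
  (forall a, l (q (g a)) <= 1)%R -> (forall b, q (h b) = 1) ->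
  closure (set_mul (\big[@set_mul F/[set 1]]_(a < m) conj_class (g a))
                   (\big[@set_mul F/[set 1]]_(b < k) conj_class (h b))
           : set (profinite F)) y ->
  (l (q y) < m.+1%:R)%R.
Proof.
move=> basis_x sofic lg qh cly.
(* Each of the [m + k] factors, and [y] itself, contributes an error of at most [d], for a total of
   1. *)
pose d : R := ((m + k).+1%:R^-1)%R.
have d0 : (0 < d)%R by rewrite invr_gt0 ltr0n.
have ev w := eventually_extends_norm l q basis_x w d0.
have [[C lC phi] [[ag ah] ay]] := eventually_ex sofic (eventually_and
  (eventually_and (eventually_forall (fun a => ev (g a)))
                  (eventually_forall (fun b => ev (h b)))) (ev y)).
have [[psi psi_x] _] := basis_x C (fun i => phi (q (x i))).
(* The coset of [y] modulo the kernel is open, so it contains a point [z] of the product itself. *)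
have [nker fker] := finite_index_kernel psi.
have [z [u /mem_prod_sets[s sg ->] [v /mem_prod_sets[t th ->] <-]] yz] :=
  (closure_profiniteP _ _).1 cly _ nker fker.
have psi_y : psi y = \prod_(a < m) psi (s a) * \prod_(b < k) psi (t b).
  move: yz; rewrite /= gmulfM morphismV => /(canRL (mulKVg _)).
  by rewrite mulg1 => <-; rewrite gmulfM
    !(big_morph psi (gmulfM (s := psi)) (morphism1 psi)).
have psiJ w w' : conj_class w w' -> lC (psi w') = lC (psi w).
  move=> [r _ <-]; rewrite conjgE !gmulfM morphismV -conjgE.
  exact: invariant_norm_conjg.
have ls a : (lC (psi (s a)) <= 1 + d)%R.
  rewrite (psiJ _ _ (sg a)); have := ag a psi psi_x; have := lg a.
  rewrite ltr_norml /= => ? /andP[? ?]; lra.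
have lt b : (lC (psi (t b)) <= d)%R.
  rewrite (psiJ _ _ (th b)); have := ah b psi psi_x.
  rewrite qh invariant_norm1 ltr_norml /= => /andP[? ?]; lra.
have lpsi_y : (lC (psi y) <= m%:R * (1 + d) + k%:R * d)%R.
  rewrite psi_y (le_trans (invariant_normM _ _ _)) // lerD //.
    apply: (le_trans (invariant_norm_prod _ _)).
    apply: (le_trans (ler_sum _ (fun i _ => ls i))).
    by rewrite sumr_const card_ord mulr_natl.
  apply: (le_trans (invariant_norm_prod _ _)).
  apply: (le_trans (ler_sum _ (fun i _ => lt i))).
  by rewrite sumr_const card_ord mulr_natl.
have dE : (m%:R * d + k%:R * d + d = 1)%R.
  have : ((m + k).+1%:R * d = 1)%R by rewrite mulfV // pnatr_eq0.
  by rewrite -natr1 natrD !mulrDl mul1r.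
have := ay psi psi_x; rewrite ltr_norml /= -natr1 => /andP[_ ?]; lra.
Qed.

(** * Separating a point from products by one subgroup of finite index *)

Lemma nbhs1_profinite (F : groupType) (U : set F) :
  nbhs (1 : profinite F) (U : set (profinite F)) <->
  exists M, [/\ normal_subgroup M, finite_index M & M `<=` U].
Proof.
split=> [|[M [nM fM MU]]].
  rewrite nbhsE => -[V [[D sD <-] [W DW W1]] sU].
  have [M [z [nM fM WE]]] := sD W DW.
  exists M; split=> // y My; apply: sU; exists W => //.
  move: W1; rewrite /= WE => -[u Mu zu]; exists (u * y).
    by case: nM => -[_ MM _] _; exact: MM.
  by rewrite mulgA zu mul1g.
apply: (filterS MU); apply: open_nbhs_nbhs; split; last by case: nM => -[].
exists [set M]; last by rewrite bigcup_set1.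
move=> V ->; exists M, 1; split=> //; apply/seteqP; split=> [y My|_ [y My <-]].
  by exists y; rewrite ?mul1g.
by rewrite mul1g.
Qed.

(** Stated near 1 and not near [x], so that conditions on different points can be intersected and
    met by a single [M]. *)
Lemma near_notin_closure (F : groupType) (A : set F) (x : F) :
  ~ closure (A : set (profinite F)) x ->
  \forall z \near (1 : profinite F), ~ A (x * z).
Proof.
move=> nclA; apply/nbhs1_profinite; apply: contrapT => nM; apply: nclA.
apply/closure_profiniteP => M nsM fM; apply: contrapT => nA; apply: nM.
exists M; split=> // z Mz Axz; apply: nA.
by exists (x * z); rewrite ?mulKg.
Qed.

(** There are finitely many choices of the classes in which the factors lie, so finitely many
    neighbourhoods of 1 are intersected. *)
Lemma near_notin_products (F : groupType) (S T : seq F) m k (x : F) :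
  (forall (g : 'I_m -> 'I_(size S)) (h : 'I_k -> 'I_(size T)),
    ~ closure (set_mul
        (\big[@set_mul F/[set 1]]_(a < m) conj_class (tnth (in_tuple S) (g a)))
        (\big[@set_mul F/[set 1]]_(b < k) conj_class (tnth (in_tuple T) (h b)))
        : set (profinite F)) x) ->
  \forall z \near (1 : profinite F),
    forall a b, product_of (conj_closure [set` S]) m a ->
      product_of (conj_closure [set` T]) k b -> x * z <> a * b.
Proof.
move=> sep.
pose I : finType := ({ffun 'I_m -> 'I_(size S)} * {ffun 'I_k -> 'I_(size T)})%type.
pose P (i : I) : set F := set_mul
  (\big[@set_mul F/[set 1]]_(a < m) conj_class (tnth (in_tuple S) (i.1 a)))
  (\big[@set_mul F/[set 1]]_(b < k) conj_class (tnth (in_tuple T) (i.2 b))).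
have : \forall z \near (1 : profinite F), forall i, ~ P i (x * z).
  apply: (@filter_forall (profinite F) I (fun i z => ~ P i (x * z))
    (nbhs (1 : profinite F)) _) => -[g h].
  by apply: near_notin_closure; exact: sep.
have index (U : seq F) w : conj_closure [set` U] w ->
    exists i : 'I_(size U), conj_class (tnth (in_tuple U) i) w.
  by move=> [u /= /(tnthP (in_tuple U))[i ->] uw]; exists i.
apply: filterS => z nz _ _ [s [Ss ->]] [t [Tt ->]] xz.
have /choice[g gs] := fun i => index _ _ (Ss i).
have /choice[h ht] := fun i => index _ _ (Tt i).
apply: (nz (finfun g, finfun h)); rewrite /= xz.
exists (\prod_(i < m) s i); first by apply/mem_prod_sets; exists s => // i; rewrite ffunE.
by exists (\prod_(i < k) t i) => //; apply/mem_prod_sets; exists t => // i; rewrite ffunE.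
Qed.

(** * Norms built from filtrations and from weights *)

Section FiltrationNorm.
Variables (R : realType) (G : groupType) (W : nat -> set G) (c : R).
Hypotheses (c0 : (0 < c)%R) (W0 : forall x, W 0 x <-> x = 1).
Hypothesis (WM : forall s t x y, W s x -> W t y -> W (s + t)%N (x * y)).
Hypothesis (WV : forall t x, W t x -> W t x^-1).
Hypothesis (WJ : forall t x y, W t x -> W t (x ^ y)).
Hypothesis (W_cover : forall x, exists t, W t x).

Let W_coverb x : exists t, `[< W t x >].
Proof. by have [t Wt] := W_cover x; exists t; apply/asboolP. Qed.

Let depth x := ex_minn (W_coverb x).

Let W_depth x : W (depth x) x.
Proof. by rewrite /depth; case: ex_minnP => t /asboolP. Qed.

Let depth_le t x : W t x -> (depth x <= t)%N.
Proof.
by rewrite /depth => Wt; case: ex_minnP => s _; apply; apply/asboolP.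
Qed.

(** The norm is [c] times the least index [t] with [W t x]: [W0] gives definiteness, [WM]
    subadditivity, [WV] and [WJ] invariance. *)
Lemma filtration_norm : exists l : invariant_norm R G,
  (forall t x, W t x -> l x <= c * t%:R)%R /\
  (forall x, exists2 t, W t x & l x = c * t%:R)%R.
Proof.
pose l x : R := (c * (depth x)%:R)%R.
have le_l x y : (depth x <= depth y)%N -> (l x <= l y)%R.
  by move=> lexy; rewrite ler_pM2l // ler_nat.
have l_ge0 x : (0 <= l x)%R by rewrite mulr_ge0 // ltW.
have l_eq0 x : l x = 0%R <-> x = 1.
  split=> [/eqP|->].
    rewrite mulf_eq0 gt_eqF //= pnatr_eq0 => /eqP d0.
    by apply/W0; rewrite -d0.
  apply/eqP; rewrite mulf_eq0 pnatr_eq0 -leqn0 depth_le ?orbT //; exact/W0.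
have lV x : l x^-1 = l x.
  apply/le_anti; rewrite !le_l //; apply: depth_le; last exact: WV.
  by rewrite -{2}[x]invgK; exact: WV.
have lM x y : (l (x * y)%g <= l x + l y)%R.
  by rewrite -mulrDr -natrD ler_pM2l // ler_nat; apply/depth_le/WM.
have lJ x y : l (y^-1 * x * y) = l x.
  rewrite -mulgA -conjgE; apply/le_anti; rewrite !le_l //; apply: depth_le.
    by rewrite -{2}[x](conjgK y); exact: WJ.
  exact: WJ.
exists (InvariantNorm l_ge0 l_eq0 lV lM lJ); split=> [t x Wt|x] /=.
  by rewrite ler_pM2l // ler_nat depth_le.
by exists (depth x).
Qed.

End FiltrationNorm.

Lemma weighted_norm (R : realType) (G : groupType) (A B : set G) (n K : nat) :
  (forall y, A y -> A y^-1) -> (forall h y, A y -> A (y ^ h)) ->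
  (forall y, B y -> B y^-1) -> (forall h y, B y -> B (y ^ h)) ->
  (0 < n)%N -> (0 < K)%N ->
  exists l : invariant_norm R G,
  [/\ forall j a, product_of A j a -> (l a <= j%:R)%R,
      forall b, B b -> (l b <= n%:R^-1)%R &
      forall r x, (r <= K)%N -> (l x < r%:R)%R ->
        exists j k a b, [/\ (j < r)%N, (k < n * K)%N,
          product_of A j a, product_of B k b & x = a * b]].
Proof.
move=> AV AJ BV BJ n0 K0.
(* Costs are counted in units of [1/n]: a factor from [A] costs [n], one from [B] costs 1. The cap
   [n * K] gives every element a finite cost. *)
pose W t x := (n * K <= t)%N \/ exists j k a b,
  [/\ (n * j + k <= t)%N, product_of A j a, product_of B k b & x = a * b].
have W0 x : W 0%N x <-> x = 1.
  split=> [[|]|->]; last first.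
  - by right; exists 0%N, 0%N, 1, 1; rewrite muln0 mulg1; split=> //; exact: product_of1.
  - move=> [j [k [a [b [+ Aa Bb ->]]]]]; rewrite leqn0 addn_eq0 muln_eq0 eqn0Ngt n0 /=.
    move=> /andP[/eqP j0 /eqP k0]; move: Aa Bb; rewrite {}j0 {}k0.
    by move=> [s [_ ->]] [t [_ ->]]; rewrite !big_ord0 mulg1.
  - by rewrite leqn0 muln_eq0 !eqn0Ngt n0 K0.
have WM s t x y : W s x -> W t y -> W (s + t)%N (x * y).
  move=> [sK _|[j [k [a [b [jk Aa Bb ->]]]]]].
    by left; apply: leq_trans sK _; rewrite leq_addr.
  move=> [tK|[j' [k' [a' [b' [jk' Aa' Bb' ->]]]]]].
    by left; apply: leq_trans tK _; rewrite leq_addl.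
  (* Moving [b] past [a'] only conjugates it: [a * b * (a' * b') = a * a' * (b ^ a' * b')]. *)
  right; exists (j + j')%N, (k + k')%N, (a * a'), (b ^ a' * b'); split.
  - by rewrite mulnDr addnACA leq_add.
  - exact: product_ofM.
  - by apply: product_ofM => //; apply: product_ofJ => //; exact: BJ.
  - by rewrite conjgE !mulgA mulgK.
have WV t x : W t x -> W t x^-1.
  move=> [tK|[j [k [a [b [jk Aa Bb ->]]]]]]; first by left.
  right; exists j, k, a^-1, (b^-1 ^ a^-1); split=> //.
  - exact: product_ofV.
  - by apply: product_ofJ; [exact: BJ|exact: product_ofV].
  - by rewrite conjgE invgK invgM !mulgA mulVg mul1g.
have WJ t x y : W t x -> W t (x ^ y).
  move=> [tK|[j [k [a [b [jk Aa Bb ->]]]]]]; first by left.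
  right; exists j, k, (a ^ y), (b ^ y); split=> //.
  - by apply: product_ofJ => //; exact: AJ.
  - by apply: product_ofJ => //; exact: BJ.
  - by rewrite conjMg.
have W_cover x : exists t, W t x by exists (n * K)%N; left.
have n'0 : (0 < n%:R^-1 :> R)%R by rewrite invr_gt0 ltr0n.
have [l [lW Wl]] := filtration_norm n'0 W0 WM WV WJ W_cover.
exists l; split.
- move=> j a Aa; suff /lW : W (n * j)%N a.
    by rewrite natrM mulKf // pnatr_eq0 -lt0n.
  by right; exists j, 0%N, a, 1; rewrite addn0 mulg1; split=> //; exact: product_of1.
- move=> b Bb; suff /lW : W 1%N b by rewrite mulr1.
  right; exists 0%N, 1%N, 1, b; rewrite muln0 mul1g.
  by split=> //; [exact: product_of1|exact: product_of_1].
- move=> r x rK; have [t Wt ->] := Wl x.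
  (* Norm below [r] means [t < n * r <= n * K], which rules out the cap; then [n * j + k <= t]
     bounds both [j] and [k]. *)
  rewrite mulrC ltr_pdivrMr ?ltr0n // -natrM ltr_nat mulnC => tr.
  have tK : (t < n * K)%N by rewrite (leq_trans tr) // leq_mul2l rK orbT.
  case: Wt => [|[j [k [a [b [jk Aa Bb xE]]]]]]; first by rewrite leqNgt tK.
  exists j, k, a, b; split=> //; last first.
    by rewrite (leq_ltn_trans _ tK) // (leq_trans _ jk) ?leq_addl.
  by rewrite -(ltn_pmul2l n0) (leq_ltn_trans _ tr) // (leq_trans _ jk) ?leq_addr.
Qed.

Lemma imageV (G H : groupType) (p : UMagmaMorphism.type G H) (A : set G) :
  (forall y, A y -> A y^-1) -> forall c, (p @` A) c -> (p @` A) c^-1.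
Proof. by move=> AV _ [y Ay <-]; exists y^-1; rewrite ?gmulfV //; exact: AV. Qed.

Lemma imageJ (G H : groupType) (p : UMagmaMorphism.type G H) (A : set G) :
  (forall d, exists x, p x = d) -> (forall h y, A y -> A (y ^ h)) ->
  forall d c, (p @` A) c -> (p @` A) (c ^ d).
Proof.
move=> surj AJ d _ [y Ay <-]; have [x <-] := surj d.
by exists (y ^ x); rewrite ?gmulfJ //; exact: AJ.
Qed.

Lemma conj_closure_id (G : groupType) (S : set G) s : S s -> conj_closure S s.
Proof. by move=> Ss; exists s => //; exists 1; rewrite ?conjg1. Qed.

Lemma conj_closureS (G : groupType) (S T : set G) :
  S `<=` T -> conj_closure S `<=` conj_closure T.
Proof. by move=> ST u [s /ST Ts us]; exists s. Qed.

Lemma symmetric_setP (G : groupType) (S : set G) :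
  symmetric_set S <-> forall x, S x -> S x^-1.
Proof.
split=> [SE x Sx|SV]; first by rewrite -SE; exists x.
apply/seteqP; split=> [_ [x Sx <-]|x Sx]; first exact: SV.
by exists x^-1; rewrite ?invgK //; exact: SV.
Qed.

(** * From closures to soficity *)

Section ClosureToSofic.
Variables (R : realType) (F : groupType) (N : set F) (hN : normal_subgroup N).
Variables (S : set F) (finS : finite_set S) (symS : symmetric_set S).
Hypothesis genS : normally_generates (quotient_map hN @` S).
Hypothesis closure_sub :
  forall (k : nat) (g : 'I_k -> F), (forall i, word_ball (conj_closure S) 1%N (g i)) ->
  forall (l : nat) (h : 'I_l -> F), (forall j, N (h j)) ->
  forall (m : nat) (i : 'I_m -> 'I_k),
    closure (set_mul (\big[@set_mul F/[set 1]]_(a < m) conj_class (g (i a)))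
                     (\big[@set_mul F/[set 1]]_(b < l) conj_class (h b))
             : set (profinite F))
    `<=` set_mul (word_ball (conj_closure S) m) N.

Let q := quotient_map hN.
Let A := conj_closure S.
Let len c := word_length (q @` A) c.

Let qM x y : q (x * y) = q x * q y. Proof. exact: gmulfM. Qed.
Let qV x : q x^-1 = (q x)^-1. Proof. exact: gmulfV. Qed.

(** A point of such a closure would have a class of length at most [m]. Adjoining 1 to [s], still
    inside the ball of radius 1, lets exactly [m] factors cover all shorter products. *)
Lemma near_notin_word_products (s T : seq F) m k x :
  S = [set` s] -> (forall t, t \in T -> N t) -> (m < len (q x))%N ->
  \forall z \near (1 : profinite F),
    forall a b, product_of (conj_closure [set` 1 :: s]) m a ->
      product_of (conj_closure [set` T]) k b -> x * z <> a * b.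
Proof.
move=> sE TN mx; apply: near_notin_products => g h.
have ball1 i : word_ball A 1 (tnth (in_tuple (1 :: s)) i).
  have := mem_tnth i (in_tuple (1 :: s)); rewrite inE => /predU1P[->|si].
    exact/(mem_word_ball _ (product_of1 _)).
  by apply: (@mem_word_ball _ _ 1) => //; apply/product_of_1/conj_closure_id; rewrite sE.
have TN' b : N (tnth (in_tuple T) (h b)) by apply/TN/mem_tnth.
move=> /(closure_sub ball1 TN')/(coset_word_ballP _ _ (conj_closureV symS)
  (image_conj_closure_gen genS)).
by rewrite leqNgt mx.
Qed.

Lemma closure_sofic : metrically_weakly_sofic (quotient_word_norm R symS genS).
Proof.
move=> E eps finE eps0.
have [e eE] := (finite_seqP _).1 finE; have [s sE] := (finite_seqP _).1 finS.
have /choice[lift liftP] c : exists x, product_of A (len c) x /\ q x = c.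
  have /word_lengthP/product_of_image[x Ax xc] :
      exists k, product_of (q @` A) k c.
    apply: generated_product; first exact: image_conj_closureV.
    by rewrite image_conj_closure_gen.
  by exists x.
have lift_len c : product_of A (len c) (lift c) by have [] := liftP c.
have liftK c : q (lift c) = c by have [] := liftP c.
pose defects := [seq (lift (g * h))^-1 * lift g * lift h | g <- e, h <- e].
(* Inverses make [T] symmetric, as the weighted norm requires; 1 allows padding to a fixed number of
   factors. *)
pose T := 1 :: defects ++ [seq x^-1 | x <- defects].
have N1 : N 1 by case: (hN) => -[].
have qN x : q x = 1 -> N x.
  rewrite /q -[in X in X -> _](gmulf1 (s := quotient_map hN)) => /esym/quotient_map_eq.
  by rewrite invg1 mul1g.
have defectN x : x \in defects -> N x.
  move=> /allpairsP[[g h] [_ _ ->]]; apply: qN.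
  by rewrite !qM qV !liftK -mulgA mulVg.
have TN x : x \in T -> N x.
  rewrite inE mem_cat => /predU1P[->//|/orP[/defectN//|/mapP[y /defectN Ny ->]]].
  by case: (hN) => -[_ _ NV] _; exact: NV.
have TV x : x \in T -> x^-1 \in T.
  rewrite !inE !mem_cat => /predU1P[->|/orP[dx|/mapP[y dy ->]]].
  - by rewrite invg1 eqxx.
  - by rewrite map_f ?orbT.
  - by rewrite invgK dy orbT.
have [n n_eps] : exists n, (n.+1%:R^-1 < eps)%R.
  by have [n] := ltr_add_invr eps0; rewrite add0r; exists n.
(* The cap [K] bounds every length on [E]; the successor keeps it positive. *)
pose K := (\max_(c <- e) len c).+1.
have lenK c : c \in e -> (len c <= K)%N.
  by move=> ce; rewrite leqW // (big_rem c) //= leq_maxl.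
pose I := 'I_(size e); pose c (i : I) := tnth (in_tuple e) i.
have c_onto g : E g -> exists i, g = c i.
  by rewrite eE => /= /(tnthP (in_tuple e)).
pose sep m x z := forall a b, product_of (conj_closure [set` 1 :: s]) m a ->
  product_of (conj_closure [set` T]) (n.+1 * K) b -> x * z <> a * b.
have near_sep m x : (m < len (q x))%N -> \forall z \near (1 : profinite F), sep m x z.
  exact: near_notin_word_products.
(* These [z] preserve lengths: a lift of length [r > 0], moved by [z], is not a product with only
   [r - 1] factors from [1 :: s]. *)
have near_len : \forall z \near (1 : profinite F), forall i,
    (0 < len (c i))%N -> sep (len (c i)).-1 (lift (c i)) z.
  apply: (@filter_forall (profinite F) I (fun i z => (0 < len (c i))%N ->
    sep (len (c i)).-1 (lift (c i)) z) (nbhs (1 : profinite F)) _) => i.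
  have [->|len0] := posnP (len (c i)); first exact: filterE.
  have := @near_sep (len (c i)).-1 (lift (c i)); rewrite liftK prednK // leqnn.
  by move=> /(_ isT); apply: filterS => z + _.
(* These [z] preserve injectivity: distinct classes have a quotient of positive length, so
   separation with [m = 0] applies. *)
have near_inj : \forall z \near (1 : profinite F), forall ij : I * I,
    c ij.1 <> c ij.2 -> sep 0%N ((lift (c ij.1))^-1 * lift (c ij.2)) z.
  apply: (@filter_forall (profinite F) (I * I)%type (fun ij z => c ij.1 <> c ij.2 ->
    sep 0%N ((lift (c ij.1))^-1 * lift (c ij.2)) z) (nbhs (1 : profinite F)) _).
  move=> [i j] /=; have [cij|/eqP cij] := eqVneq (c i) (c j); first exact: filterE.
  have : \forall z \near (1 : profinite F), sep 0%N ((lift (c i))^-1 * lift (c j)) z.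
    apply: near_sep; rewrite lt0n; apply: contra_notN cij => /eqP l0.
    have : (quotient_word_norm R symS genS) (q ((lift (c i))^-1 * lift (c j))) = 0%R.
      by rewrite /= -/q -/A -/(len _) l0.
    move=> /invariant_norm_eq0; rewrite qM qV !liftK => /(canRL (mulVKg _)) ->.
    by rewrite mulg1.
  by apply: filterS => z + _.
have [M [nM fM sepM]] := (nbhs1_profinite _).1 (filterI near_len near_inj).
have [C [p [p_onto kerp]]] := finite_quotient nM fM.
pose A' := conj_closure [set` 1 :: s]; pose B := conj_closure [set` T].
have A'V : forall y, A' y -> A' y^-1.
  apply: conj_closureV; apply/symmetric_setP => x /=.
  rewrite !inE => /predU1P[->|sx]; first by rewrite invg1 eqxx.
  have /symmetric_setP/(_ x) : symmetric_set S by [].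
  by rewrite sE /= => -> //; rewrite orbT.
have BV : forall y, B y -> B y^-1.
  by apply: conj_closureV; apply/symmetric_setP => x /=; exact: TV.
have AA' : A `<=` A' by apply: conj_closureS; rewrite sE => x /= sx; rewrite inE sx orbT.
have A'1 : A' 1 by apply: conj_closure_id; rewrite /= inE eqxx.
have B1 : B 1 by apply: conj_closure_id; rewrite /= inE eqxx.
have [lC [lA lB l_lt]] := weighted_norm R (imageV A'V)
  (imageJ p_onto (@conj_closureJ _ _)) (imageV BV)
  (imageJ p_onto (@conj_closureJ _ _)) (ltn0Sn n) (ltn0Sn _ : 0 < K)%N.
have pMP x y : p x = p y -> M (x^-1 * y).
  by move=> pxy; apply/kerp; rewrite gmulfM gmulfV pxy mulVg.
have lC_lift_le g : (lC (p (lift g)) <= (len g)%:R)%R.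
  by apply: lA; apply: image_product_of; exact: product_of_sub (lift_len g).
exists C, lC, (p \o lift); split=> /=.
- move=> g h; rewrite !inE => /c_onto[i ->] /c_onto[j ->] /pMP Mij.
  (* For the pair [(j, i)] and [z = (lift (c i))^-1 * lift (c j)] the separated product collapses to
     1, which is a product of trivial factors. *)
  apply: contrapT => cij; have [_ /(_ (j, i))/=] := sepM _ Mij.
  have := product_of_sub (fun _ => id) B1 (leq0n (n.+1 * K)) (product_of1 B).
  move=> B1' /(_ (fun ji => cij (esym ji)))/(_ 1 1 (product_of1 _) B1').
  by rewrite mulgA mulgK mulVg mulg1.
(* The defect of the map is the image of an element of [defects], hence has norm at most
   [n.+1%:R^-1]. *)
- move=> g h Eg Eh Egh; apply: le_lt_trans n_eps; apply: lB.
  exists ((lift (g * h))^-1 * lift g * lift h); last by rewrite !gmulfM gmulfV.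
  apply: conj_closure_id => /=; rewrite inE mem_cat.
  suff -> : (lift (g * h))^-1 * lift g * lift h \in defects by rewrite orbT.
  by rewrite eE in Eg Eh; apply/allpairsP; exists (g, h).
- move=> _; apply: le_lt_trans (lC_lift_le 1) _; apply: le_lt_trans n_eps.
  have -> : (len 1)%:R%R = quotient_word_norm R symS genS 1 by [].
  by rewrite invariant_norm1 invr_ge0 ler0n.
- move=> g /c_onto[i ->]; suff -> : lC (p (lift (c i))) = (len (c i))%:R%R.
    by rewrite subrr normr0.
  apply/le_anti; rewrite lC_lift_le /= leNgt; apply/negP => lt_len.
  (* A smaller norm would write the lift, modulo [M], with [j < len (c i)] factors from [1 :: s] and
     fewer than [n.+1 * K] from [T]; padding both contradicts the separation. *)
  have [j [k [_ [_ [jlen kK /product_of_image[a Aa <-] /product_of_image[b Bb <-]]]]]]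
    := l_lt _ _ (lenK _ (mem_tnth i (in_tuple e))) lt_len.
  rewrite -gmulfM => /pMP Mz; have len0 := leq_ltn_trans (leq0n j) jlen.
  have [/(_ i len0 a b) + _] := sepM _ Mz; apply; last by rewrite mulVKg.
    by apply: product_of_sub Aa => //; rewrite -ltnS prednK.
  by apply: product_of_sub Bb => //; exact: ltnW.
Qed.

End ClosureToSofic.

Theorem theorem4p1 (R : realType) (F : groupType) (hF : fin_gen_free F)
    (N : set F) (hN : normal_subgroup N)
    (S : set F) (finS : finite_set S) (symS : symmetric_set S)
    (genS : normally_generates (quotient_map hN @` S)) :
  metrically_weakly_sofic (quotient_word_norm R symS genS) <->
  forall (k : nat) (g : 'I_k -> F), (forall i, word_ball (conj_closure S) 1%N (g i)) ->
  forall (l : nat) (h : 'I_l -> F), (forall j, N (h j)) ->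
  forall (m : nat) (i : 'I_m -> 'I_k),
    closure (set_mul (\big[@set_mul F/[set 1]]_(a < m) conj_class (g (i a)))
                     (\big[@set_mul F/[set 1]]_(b < l) conj_class (h b))
             : set (profinite F))
    `<=` set_mul (word_ball (conj_closure S) m) N.
Proof.
split; last exact: closure_sofic.
move=> sofic k g gB l h hN' m i y cly.
have [n [x basis_x]] := hF.
have ballP j z := coset_word_ballP j z (conj_closureV symS) (image_conj_closure_gen genS).
have qh b : quotient_map hN (h b) = 1.
  rewrite -[RHS](gmulf1 (s := quotient_map hN)); apply/esym/quotient_map_eq.
  by rewrite invg1 mul1g.
(* Lengths are integers, so the real bound [< m.+1] is enough for [<= m]. *)
apply/ballP; rewrite -ltnS -(ltr_nat R).
apply: (sofic_closure_norm basis_x sofic _ qh cly) => a /=.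
rewrite (ler_nat R _ 1); apply/ballP; exists (g (i a)); first exact: gB.
by exists 1; rewrite ?mulg1 //; case: (hN) => -[].
Qed.
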